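(* Let $k\ge 3$ be an integer and let $G$ be a graph of order $n\ge k$. Then $$\tau_k(G)\le \min_{S\subseteq V(G),\,|S|=k}\left\lfloor \frac{1}{k}\,|E_G[S,\bar S]|\right\rfloor,$$ where $\bar S=V(G)\setminus S$. Moreover, the bound is sharp, i.e. there are graphs for which equality holds.
   Context: All graphs are finite, simple and undirected. For $S\subseteq V(G)$ with $|S|\ge 2$, an $S$-Steiner tree is a subgraph of $G$ that is a tree containing $S$ in its vertex set. A pedant (pendant) $S$-Steiner tree is an $S$-Steiner tree in which every vertex of $S$ has degree exactly one. Two pedant $S$-Steiner trees $T,T'$ are internally disjoint if $E(T)\cap E(T')=\emptyset$ and $V(T)\cap V(T')=S$. $\tau_G(S)$ denotes the maximum number of pairwise internally disjoint pedant $S$-Steiner trees in $G$, and for $2\le k\le n$, $\tau_k(G)=\min\{\tau_G(S): S\subseteq V(G),\ |S|=k\}$; by convention $\tau_k(G)=0$ when $G$ is disconnected. $E_G[S,\bar S]$ denotes the set of edges of $G$ with one end in $S$ and the other in $\bar S$. *)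

(* Defs.v *)
From HB Require Import structures.
From mathcomp Require Import all_boot.

Set Implicit Arguments.
Unset Strict Implicit.
Unset Printing Implicit Defensive.

Record sgraph := SGraph {
  vertex :> finType;
  edge : rel vertex;
  edge_sym : symmetric edge;
  edge_irrefl : irreflexive edge }.

(* An edge is the two-element set of its ends. *)
Definition edges (G : sgraph) : {set {set G}} :=
  [set [set p.1; p.2] | p : G * G & edge p.1 p.2].

(* A pair (vertex set, edge set); is_subgraph says when it is a subgraph of G. *)
Definition subgraph (G : sgraph) : Type := ({set G} * {set {set G}})%type.

Section Subgraphs.
Variable G : sgraph.
Implicit Types (H T : subgraph G) (S : {set G}).

Definition vset H : {set G} := H.1.
Definition eset H : {set {set G}} := H.2.

Definition is_subgraph H : bool :=
  (eset H \subset edges G) && [forall f in eset H, f \subset vset H].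

Definition adj H : rel G := [rel x y | [set x; y] \in eset H].

Definition degree H (x : G) : nat := #|[set f in eset H | x \in f]|.

Definition connected H : bool :=
  (vset H != set0) && [forall x in vset H, forall y in vset H, connect (adj H) x y].

(* A cycle is a duplicate-free sequence of at least 3 vertices; bounding its
   length by #|G| only serves to make the quantifier finite (see acyclicP). *)
Definition acyclic H : bool :=
  [forall n : 'I_(#|G|.+1), forall c : n.-tuple G,
     ~~ [&& 2 < n, uniq c & cycle (adj H) c]].

Lemma acyclicP H :
  reflect (forall c : seq G, 2 < size c -> uniq c -> ~~ cycle (adj H) c)
          (acyclic H).
Proof.
apply: (iffP forallP) => [acH c c3 uc | acH n].
  have cG : size c < #|G|.+1 by rewrite ltnS -(card_uniqP uc) max_card.
  have /forallP/(_ (in_tuple c)) := acH (Ordinal cG).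
  by rewrite /= c3 uc.
apply/forallP => c; apply/negP => /and3P[n3 uc cc].
by have := acH c; rewrite size_tuple n3 uc cc => /(_ isT isT).
Qed.

Definition is_tree H : bool := connected H && acyclic H.

Definition steiner_tree S T : bool :=
  [&& is_subgraph T, is_tree T & S \subset vset T].

Definition pendant_steiner_tree S T : bool :=
  steiner_tree S T && [forall x in S, degree T x == 1].

Definition internally_disjoint S T T' : bool :=
  (eset T :&: eset T' == set0) && (vset T :&: vset T' == S).

Definition disjoint_family S (P : {set subgraph G}) : bool :=
  [forall T in P, pendant_steiner_tree S T] &&
  [forall T in P, forall T' in P, (T != T') ==> internally_disjoint S T T'].

Definition tau_set S : nat :=
  \max_(P : {set subgraph G} | disjoint_family S P) #|P|.

(* Minimum of F over the k-subsets of V(G), for k <= #|G|. Since nat has no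
   greatest element, minn is seeded with the maximum of the same values, which
   is at least the minimum and so has no effect; see min_ksub_le and min_ksub_attained. *)
Definition min_ksub (k : nat) (F : {set G} -> nat) : nat :=
  let M := \max_(S : {set G} | #|S| == k) F S in
  \big[minn/M]_(S : {set G} | #|S| == k) F S.

Lemma min_ksub_le k F S : #|S| = k -> min_ksub k F <= F S.
Proof.
move=> /eqP Sk; rewrite /min_ksub; set M := \max_(_ | _) _.
have : S \in index_enum {set G} by rewrite mem_index_enum.
elim: (index_enum _) => // A r IHr; rewrite inE big_cons => /predU1P[<-|Sr].
  by rewrite Sk geq_minl.
by case: ifP => _; rewrite ?(leq_trans (geq_minr _ _)) ?IHr.
Qed.

Lemma min_ksub_attained k F :
  k <= #|G| -> exists2 S : {set G}, #|S| = k & min_ksub k F = F S.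
Proof.
move=> kG; have [S0 /eqP S0k] : exists S0 : {set G}, #|S0| == k.
  exists [set x in take k (enum G)]; rewrite cardsE.
  have /card_uniqP-> : uniq (take k (enum G)) by rewrite take_uniq ?enum_uniq.
  by rewrite size_takel // -cardE.
rewrite /min_ksub; elim/big_rec: _ => [|S m /eqP Sk [A Ak ->]].
  have cS : 0 < #|[pred S : {set G} | #|S| == k]|.
    by apply/card_gt0P; exists S0; rewrite inE S0k.
  by have [S /eqP Sk ->] := eq_bigmax_cond F cS; exists S.
by rewrite /minn; case: ifP => _; [exists S | exists A].
Qed.

End Subgraphs.

Definition whole (G : sgraph) : subgraph G := ([set: G], edges G).

Definition tau (k : nat) (G : sgraph) : nat :=
  if connected (whole G) then min_ksub k (@tau_set G) else 0.

Definition edge_cut (G : sgraph) (S : {set G}) : {set {set G}} :=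
  [set f in edges G | [exists x in S, exists y in ~: S, f == [set x; y]]].

(* Main.v *)
Require Import Defs.
From mathcomp Require Import all_boot.

Set Implicit Arguments.
Unset Strict Implicit.
Unset Printing Implicit Defensive.

(** In a pendant S-Steiner tree with |S| >= 3, the unique edge at a vertex of S
    leaves S: an edge between two leaves would be a whole component. So each
    tree contains k distinct edges of the cut, and edge-disjointness of the
    trees gives the bound. In the complete graph on k + 1 vertices, the star
    centred at the only vertex outside S shows that both sides are equal to 1. *)

Section Graph.
Variable G : sgraph.
Implicit Types (S : {set G}) (T : subgraph G) (P : {set subgraph G}).

Lemma adj_sym T : symmetric (adj T).
Proof. by move=> x y; rewrite /adj /= setUC. Qed.

(** This lets an edge of the cut determine the vertex of S it was chosen for, which is half of the
    injectivity argument in [disjoint_family_edge_cut]. *)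
Lemma edge_cut_uniq S f x y :
  f \in edge_cut S -> x \in S -> y \in S -> x \in f -> y \in f -> x = y.
Proof.
rewrite inE => /andP[_ /exists_inP[a aS /exists_inP[b]]].
rewrite inE => bS /eqP-> xS yS.
have inS z : z \in S -> z \in [set a; b] -> z = a.
  by move=> zS /set2P[//|zb]; rewrite -zb zS in bS.
by move=> /(inS _ xS)-> /(inS _ yS)->.
Qed.

Lemma mem_edge_cut S f :
  f \in edges G -> (exists x, x \in f :&: S) -> (exists y, y \in f :\: S) ->
  f \in edge_cut S.
Proof.
rewrite inE => fE [x /setIP[xf xS]] [y /setDP[yf yS]]; rewrite fE /=.
apply/exists_inP; exists x => //; apply/exists_inP; exists y; rewrite ?inE //.
have xy : x != y by apply: contraNneq yS => <-.
case/imsetP: fE xf yf => -[a b] _ -> /= /set2P[] xE /set2P[] yE.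
- by rewrite xE yE eqxx in xy.
- by rewrite xE yE.
- by rewrite xE yE setUC.
- by rewrite xE yE eqxx in xy.
Qed.

Lemma pendant_edge_uniq S T x f g :
  pendant_steiner_tree S T -> x \in S ->
  f \in eset T -> g \in eset T -> x \in f -> x \in g -> f = g.
Proof.
move=> /andP[_ /forall_inP degS] /degS/cards1P[h hE] fT gT xf xg.
have /set1P-> : f \in [set h] by rewrite -hE inE fT.
by have /set1P-> : g \in [set h] by rewrite -hE inE gT.
Qed.

Lemma pendant_edge_in_cut S T x f :
  2 < #|S| -> pendant_steiner_tree S T -> x \in S ->
  f \in eset T -> x \in f -> f \in edge_cut S.
Proof.
move=> S3 TP xS fT xf.
have /andP[/and3P[/andP[/subsetP TE _] /andP[/andP[_ Tc] _] /subsetP ST] _] := TP.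
have fE := TE _ fT.
apply: mem_edge_cut => //; first by exists x; rewrite inE xf.
apply/set0Pn; rewrite setD_eq0; apply/negP => /subsetP fS.
(* Under the assumption that both ends of f lie in S, f is the only tree edge at either end, so
   adjacency in T never leaves f. Connectedness of T then forces S into f, which has at most two
   vertices. *)
have f_closed : closed (adj T) f.
  apply: intro_closed; first exact/sym_connect_sym/adj_sym.
  move=> u v /= uvT uf.
  by rewrite (pendant_edge_uniq TP (fS _ uf) fT uvT) ?set21 ?set22.
have Sf : S \subset f.
  apply/subsetP => z zS.
  move/forall_inP: Tc => /(_ x (ST _ xS))/forall_inP/(_ z (ST _ zS)).
  by move/(closed_connect f_closed) <-.
have f2 : #|f| <= 2 by case/imsetP: fE => -[a b] _ ->; rewrite cards2; case: eqP.
by have := leq_trans S3 (leq_trans (subset_leq_card Sf) f2).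
Qed.

Lemma disjoint_family_edge_cut S P :
  2 < #|S| -> disjoint_family S P -> #|P| * #|S| <= #|edge_cut S|.
Proof.
move=> S3 /andP[/forall_inP PS /forall_inP Pdis].
(* The edge of the tree p.1 at the vertex p.2. The default [set0] never arises for a tree of P and a
   vertex of S, since degree one supplies an edge. *)
pose e (p : subgraph G * G) : {set G} :=
  odflt set0 [pick f in eset p.1 | p.2 \in f].
have eP T x : T \in P -> x \in S -> (e (T, x) \in eset T) /\ (x \in e (T, x)).
  move=> TP xS; rewrite /e /=; case: pickP => [f /andP[] //|noe].
  have /andP[_ /forall_inP/(_ x xS)/cards1P[h hE]] := PS T TP.
  by have := set11 h; rewrite -hE inE noe.
have e_cut T x : T \in P -> x \in S -> e (T, x) \in edge_cut S.
  by move=> TP xS; have [] := eP T x TP xS; apply: pendant_edge_in_cut (PS T TP) _.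
(* The product counts the pairs in P x S, and [e] maps them injectively into the cut. *)
rewrite -cardsX -(@card_in_imset _ _ e).
  apply/subset_leq_card/subsetP => _ /imsetP[[T x] /setXP[TP xS] ->].
  exact: e_cut.
move=> [T x] [T' x'] /setXP[/= TP xS] /setXP[/= TP' xS'] ee.
have [eT xe] := eP T x TP xS; have [eT' xe'] := eP T' x' TP' xS'.
rewrite -ee in eT' xe'.
(* A shared edge has one end in S, so the vertices agree; distinct trees share no edge, so the trees
   agree. *)
rewrite (edge_cut_uniq (e_cut _ _ TP xS) xS xS' xe xe').
have [-> //|TT'] := eqVneq T T'.
have /forall_inP/(_ T' TP') := Pdis T TP.
rewrite TT' => /andP[/eqP/setP/(_ (e (T, x)))].
by rewrite inE eT eT' in_set0.
Qed.

Lemma tau_set_edge_cut S : 2 < #|S| -> tau_set S <= #|edge_cut S| %/ #|S|.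
Proof.
move=> S3; apply/bigmax_leqP => P PS.
by rewrite leq_divRL ?disjoint_family_edge_cut // (leq_trans _ S3).
Qed.

Lemma tau_edge_cut k : 2 < k -> k <= #|G| ->
  tau k G <= min_ksub k (fun S : {set G} => #|edge_cut S| %/ k).
Proof.
move=> k3 kG; rewrite /tau; case: ifP => // _.
(* A set S minimizing the right-hand side suffices, because the left-hand minimum is at most its
   value at this S. *)
have [S Sk ->] := min_ksub_attained (fun S : {set G} => #|edge_cut S| %/ k) kG.
apply: leq_trans (min_ksub_le _ Sk) _.
by rewrite -Sk tau_set_edge_cut // Sk.
Qed.

Definition star S (v : G) : subgraph G := (v |: S, [set [set x; v] | x in S]).

Lemma star_adj_center S v x y : adj (star S v) x y -> (x == v) || (y == v).
Proof.
by case/imsetP => z _ /setP/(_ v); rewrite !inE eqxx orbT !(eq_sym v).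
Qed.

Lemma star_connected S v : connected (star S v).
Proof.
apply/andP; split; first by apply/set0Pn; exists v; apply: setU11.
have csym : connect_sym (adj (star S v)) by exact/sym_connect_sym/adj_sym.
have to_v x : x \in v |: S -> connect (adj (star S v)) x v.
  move=> /setU1P[-> //|xS]; apply/connect1/imsetP; by exists x.
apply/forall_inP => x xS; apply/forall_inP => y yS.
by rewrite (connect_trans (to_v x xS)) // csym to_v.
Qed.

(** Every edge contains v. In a cycle a, b, d, ..., the edge ab gives v = a or v = b. If v = a, the
    edge bd misses v; if v = b, the closing edge at a forces the last vertex to be b again. *)
Lemma star_acyclic S v : acyclic (star S v).
Proof.
apply/acyclicP => -[|a [|b [|d s]]] //= _.
rewrite !inE !negb_or => /and3P[/and3P[ab ad _] /andP[bd bs] _].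
apply/negP; rewrite rcons_path => /and4P[/star_adj_center abv].
move=> /star_adj_center bdv _ /star_adj_center lav.
case/orP: abv => /eqP E; rewrite {}E in ab ad bd bs bdv lav.
  by rewrite !(eq_sym _ v) (negPf ab) (negPf ad) in bdv.
rewrite (negPf ab) orbF in lav.
have := mem_last d s; rewrite (eqP lav) inE.
by rewrite (negPf bd) (negPf bs).
Qed.

Lemma star_pendant S v :
  v \notin S -> {in S, forall x, edge x v} -> pendant_steiner_tree S (star S v).
Proof.
move=> vS Sv; apply/andP; split.
  apply/and3P; split; last exact: subsetUr.
    apply/andP; split.
      apply/subsetP => _ /imsetP[x xS ->]; apply/imsetP.
      by exists (x, v); rewrite // inE Sv.
    apply/forall_inP => _ /imsetP[x xS ->]; apply/subsetP => z.
    by move=> /set2P[] ->; rewrite !inE ?xS ?eqxx ?orbT.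
  by rewrite /is_tree star_connected star_acyclic.
apply/forall_inP => x xS; apply/cards1P; exists [set x; v].
apply/setP => f; rewrite !inE; apply/andP/eqP => [[/imsetP[y yS ->]]|->].
  by move=> /set2P[-> //|xv]; rewrite -xv xS in vS.
by rewrite set21; split=> //; apply/imsetP; exists x.
Qed.

Lemma tau_set_gt0 S T : pendant_steiner_tree S T -> 0 < tau_set S.
Proof.
(* The witness is the family consisting of T alone, for which disjointness is vacuous. *)
move=> ST; rewrite -(cards1 T); apply: leq_bigmax_cond.
apply/andP; split; apply/forall_inP => T1 /set1P-> //.
by apply/forall_inP => T2 /set1P->; rewrite eqxx.
Qed.

End Graph.

Lemma neq_sym (V : eqType) : symmetric (fun x y : V => x != y).
Proof. by move=> x y; rewrite eq_sym. Qed.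

Lemma neq_irrefl (V : eqType) : irreflexive (fun x y : V => x != y).
Proof. by move=> x; rewrite eqxx. Qed.

Definition complete (V : finType) : sgraph :=
  SGraph (@neq_sym V) (@neq_irrefl V).

Lemma complete_connected (V : finType) :
  0 < #|V| -> connected (whole (complete V)).
Proof.
move=> V0; apply/andP; split; first by rewrite -card_gt0 cardsT.
apply/forall_inP => x _; apply/forall_inP => y _.
have [-> //|xy] := eqVneq x y.
by apply/connect1/imsetP; exists (x, y); rewrite ?inE.
Qed.

Lemma card1_compl (V : finType) (S : {set V}) : #|V| = #|S|.+1 ->
  exists v, ~: S = [set v].
Proof.
by move=> VS; apply/cards1P; rewrite cardsCs setCK VS subSnn.
Qed.

Lemma complete_tau_gt0 (V : finType) k : #|V| = k.+1 -> 0 < tau k (complete V).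
Proof.
move=> Vk; rewrite /tau complete_connected ?Vk //.
have [|S Sk ->] := @min_ksub_attained (complete V) k (@tau_set _).
  by rewrite Vk.
have [|v /setP SE] := @card1_compl V S; first by rewrite Vk Sk.
have vS : v \notin S by have := SE v; rewrite !inE eqxx.
apply: (@tau_set_gt0 _ S (star S v)); apply: star_pendant => // x xS.
by apply: contraNneq vS => <-.
Qed.

Lemma complete_edge_cut (V : finType) (S : {set complete V}) :
  #|V| = #|S|.+1 -> #|edge_cut S| <= #|S|.
Proof.
case/card1_compl => v SE.
(* Each cut edge must end at v, the only vertex outside S, so it is determined by its end in S. *)
apply: leq_trans (leq_imset_card (fun x => [set x; v]) S).
apply/subset_leq_card/subsetP => f; rewrite inE => /andP[_].
move=> /exists_inP[x xS /exists_inP[y]]; rewrite SE => /set1P-> /eqP->.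
by apply/imsetP; exists x.
Qed.

(** Sharpness is shown for every k, and [0 < tau k G] rules out the trivial equality 0 = 0 given by
    edgeless graphs. *)
Theorem theorem1 (k : nat) (hk : 3 <= k) :
  (forall G : sgraph, k <= #|G| ->
     tau k G <= min_ksub k (fun S : {set G} => #|edge_cut S| %/ k))
  /\
  (exists G : sgraph,
     [/\ k <= #|G|,
         0 < tau k G
       & tau k G = min_ksub k (fun S : {set G} => #|edge_cut S| %/ k)]).
Proof.
split=> [G|]; first exact: tau_edge_cut.
have Vk := card_ord k.+1.
have kG : k <= #|complete 'I_k.+1| by rewrite Vk.
exists (complete 'I_k.+1); split=> //; first exact: complete_tau_gt0.
apply/eqP; rewrite eqn_leq tau_edge_cut //=.
have [S Sk ->] :=
  min_ksub_attained (fun S : {set complete 'I_k.+1} => #|edge_cut S| %/ k) kG.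
(* As [tau] is at least 1, it remains to bound the quotient by 1: the cut has at most k edges, and k
   %/ k = 1. *)
apply: leq_trans (complete_tau_gt0 Vk).
have cutS : #|edge_cut S| <= k.
  by apply: leq_trans (complete_edge_cut _) _; rewrite Sk.
by rewrite (leq_trans (leq_div2r k cutS)) // divnn; case: (0 < k).
Qed.
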